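(* For any permutree $S$, the coproduct $\triangle\mathbb P_S$ in the permutree algebra is given by $$\triangle\mathbb P_S=\sum_\gamma\Big(\prod_{T\in B(S,\gamma)}\mathbb P_T\Big)\otimes\Big(\prod_{T'\in A(S,\gamma)}\mathbb P_{T'}\Big),$$ where $\gamma$ runs over all cuts of $S$ and the products are computed from left to right.
   Context: Permutrees. A decoration of size $n$ is a word $\delta=\delta_1\cdots\delta_n$ in the symbols $\mathsf N$ (none), $\mathsf D$ (down), $\mathsf U$ (up), $\mathsf X$ (both). A permutree is a directed tree $T$ with $n$ vertices labeled bijectively by $[n]=\{1,\dots,n\}$ (vertices are identified with labels) in which each vertex has one or two parents (outgoing neighbors) and one or two children (incoming neighbors); a parent or child may be an unlabeled leaf (an up leaf, resp. down leaf), so ancestor and descendant subtrees may be empty. The ancestor (resp. descendant) subtree of $i$ through a given parent (resp. child) is the whole connected component, reached through it, of the tree with $i$ removed. If $i$ has two parents (resp. children), they are distinguished as left and right, and all labels in the left ancestor (resp. descendant) subtree of $i$ are smaller than $i$ while all labels in the right one are larger than $i$. The decoration of $T$ is given by $\delta(T)_i=\mathsf N,\mathsf D,\mathsf U,\mathsf X$ according to whether $i$ has (one parent, one child), (one parent, two children), (two parents, one child), (two parents, two children). Permutrees are drawn with edges oriented upwards and vertices from left to right by labels. Cuts. A cut of a permutree $S$ is a set $\gamma$ of edges (edges to leaves included) such that every upward directed path of $S$ from a down leaf to an up leaf (a ''geodesic vertical path'') contains precisely one edge of $\gamma$. Cutting the edges of $\gamma$ separates $S$ into two forests of permutrees, $A(S,\gamma)$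 above $\gamma$ and $B(S,\gamma)$ below $\gamma$, whose trees are ordered from left to right and whose labels are standardized on each tree. A tree reduced to a strand without vertex is the empty permutree, and contributes the unit. Algebra. A decorated permutation is a permutation of some $[n]$, $n\ge 0$, each of whose letters carries a decoration in $\{\mathsf N,\mathsf D,\mathsf U,\mathsf X\}$. Consider the Hopf algebra (over a fixed field) with basis $(\mathbb F_\tau)$ indexed by decorated permutations, with product $\mathbb F_\tau\cdot\mathbb F_{\tau'}=\sum_\sigma\mathbb F_\sigma$ where $\sigma$ runs over all shuffles of the word $\tau$ with the word $\tau'$ whose values are all shifted by the length of $\tau$ (decorations travelling with values), and coproduct $\triangle\mathbb F_\sigma=\sum_{k=0}^{n}\mathbb F_{\mathrm{std}(\sigma_1\cdots\sigma_k)}\otimes\mathbb F_{\mathrm{std}(\sigma_{k+1}\cdots\sigma_n)}$, where $\mathrm{std}$ denotes standardization, each letter keeping its decoration (equivalently, the sum over $(\tau,\tau')$ such that $\sigma$ is in the convolution $\tau\star\tau'$). For a permutree $T$, $\mathbb P_T=\sum_\tau\mathbb F_\tau$ over all linear extensions $\tau$ of $T$ (permutations where $i$ appears before $j$ for each edge $i\to j$ of $T$), with each value $i$ decorated by $\delta(T)_i$. The permutree algebra is the Hopf subalgebra spanned by the $\mathbb P_T$. *)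

(* Defs.v *)
From HB Require Import structures.
From mathcomp Require Import all_boot all_order all_algebra.
From mathcomp Require Import finmap.
From mathcomp.multinomials Require Import monalg.
From mathcomp Require Import boolp.

Set Implicit Arguments.
Unset Strict Implicit.
Unset Printing Implicit Defensive.

Import GRing.Theory.
Local Open Scope ring_scope.

Variant deco := DecoN | DecoD | DecoU | DecoX.

(* (two parents?, two children?) *)
Definition bools_of_deco (d : deco) : bool * bool :=
  match d with
  | DecoN => (false, false)
  | DecoD => (false, true)
  | DecoU => (true, false)
  | DecoX => (true, true)
  end.

Definition deco_of_bools (b : bool * bool) : deco :=
  match b with
  | (false, false) => DecoN
  | (false, true) => DecoD
  | (true, false) => DecoU
  | (true, true) => DecoX
  end.

Lemma bools_of_decoK : cancel bools_of_deco deco_of_bools.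
Proof. by case. Qed.

HB.instance Definition _ := Choice.copy deco (can_type bools_of_decoK).

(* A letter is a value together with its decoration; a decorated permutation
   is given by its one-line notation, with values 1, ..., n. *)
Notation word := (seq (nat * deco)).

Definition is_dperm (w : word) : bool := perm_eq (unzip1 w) (iota 1 (size w)).

Record dperm := DPerm { dpword :> word; _ : is_dperm dpword }.

HB.instance Definition _ := [isSub for dpword].
HB.instance Definition _ := [Choice of dperm by <:].

Definition dperm0 : dperm := @DPerm [::] isT.

(* Only meant for words satisfying is_dperm; see is_dperm_std,
   is_dperm_shuffles and is_dperm_vword below. *)
Definition to_dperm (w : word) : dperm := insubd dperm0 w.

Definition std_value (w : word) (a : nat) : nat :=
  count (fun y => y.1 <= a)%N w.

Definition std (w : word) : word := [seq (std_value w x.1, x.2) | x <- w].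

Definition shift (k : nat) (w : word) : word :=
  [seq ((k + x.1)%N, x.2) | x <- w].

Fixpoint shuffles (T : Type) (s : seq T) {struct s} : seq T -> seq (seq T) :=
  fix shuffles_s (t : seq T) : seq (seq T) :=
    match s, t with
    | [::], _ => [:: t]
    | _, [::] => [:: s]
    | x :: s', y :: t' =>
        [seq x :: w | w <- shuffles s' t] ++ [seq y :: w | w <- shuffles_s t']
    end.

Lemma is_dperm_uniq (w : word) : is_dperm w -> uniq (unzip1 w).
Proof. by move=> h; rewrite (perm_uniq h) iota_uniq. Qed.

Lemma perm_iota1 (s : seq nat) (n : nat) :
  uniq s -> size s = n -> {in s, forall a, (1 <= a <= n)%N} ->
  perm_eq s (iota 1 n).
Proof.
move=> us sn sb; apply: uniq_perm (iota_uniq _ _) _ => //.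
apply: (uniq_min_size us _ _).2; last by rewrite size_iota sn.
by move=> a /sb; rewrite mem_iota add1n ltnS.
Qed.

Lemma std_value_lt (w : word) (a b : nat) :
  b \in unzip1 w -> (a < b)%N -> (std_value w a < std_value w b)%N.
Proof.
move=> bw ab; elim: w bw => //= y w IH; rewrite inE => /predU1P[yb|/IH{}IH].
  have [ya ->] : (y.1 <= a)%N = false /\ (y.1 <= b)%N.
    by rewrite -yb leqnn leqNgt ab.
  rewrite ya add0n add1n ltnS.
  by apply: sub_count => z /= za; apply: leq_trans za (ltnW ab).
rewrite -addnS leq_add //; case: (leqP y.1 a) => // ya.
by rewrite (leq_trans ya (ltnW ab)).
Qed.

Lemma is_dperm_std (w : word) : uniq (unzip1 w) -> is_dperm (std w).
Proof.
move=> uw; rewrite /is_dperm /std size_map.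
have -> : unzip1 [seq (std_value w x.1, x.2) | x <- w] =
         [seq std_value w a | a <- unzip1 w] by rewrite /unzip1 -!map_comp.
apply: perm_iota1; rewrite ?size_map //.
  rewrite map_inj_in_uniq // => a b aw bw ab.
  by case: (ltngtP a b) => // lt;
     [move: (std_value_lt bw lt) | move: (std_value_lt aw lt)]; rewrite ab ltnn.
move=> _ /mapP[_ /mapP[x xw ->] ->]; rewrite count_size andbT -has_count.
by apply/hasP; exists x => /=.
Qed.

Lemma perm_shuffles (T : eqType) (s t w : seq T) :
  w \in shuffles s t -> perm_eq w (s ++ t).
Proof.
elim: s t w => [|x s IHs] t; first by case: t => [|y t] w;
  rewrite inE => /eqP ->.
elim: t => [|y t IHt] w; first by rewrite inE => /eqP ->; rewrite cats0.
rewrite mem_cat => /orP[] /mapP[v vin ->].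
  by rewrite /= perm_cons; apply: IHs.
rewrite perm_sym perm_catC /= perm_cons perm_catC perm_sym.
exact: IHt.
Qed.

Lemma is_dperm_shuffles (s t w : word) :
  is_dperm s -> is_dperm t -> w \in shuffles s (shift (size s) t) -> is_dperm w.
Proof.
move=> hs ht /perm_shuffles hw; rewrite /is_dperm.
apply: perm_trans (perm_map _ hw) _.
rewrite (perm_size hw) map_cat size_cat size_map iotaD addnC.
apply: perm_cat => //.
have -> : [seq x.1 | x <- shift (size s) t] = [seq (size s + a)%N | a <- unzip1 t]
  by rewrite /shift /unzip1 -!map_comp.
by rewrite iotaDl; apply: perm_map.
Qed.

Section HopfAlgebra.
Variable K : fieldType.

(* The underlying space of the Hopf algebra and that of its tensor square,
   the basis element F_s (x) F_t of the latter being indexed by (s, t). *)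
Local Notation H := {malg K[dperm]}.
Local Notation HH := {malg K[(dperm * dperm)%type]}.

Definition basisF (s : dperm) : H := << s >>.

Definition mulF (s t : dperm) : H :=
  \sum_(w <- shuffles (s : word) (shift (size s) t)) basisF (to_dperm w).

Definition coprodF (s : dperm) : HH :=
  \sum_(k < (size s).+1)
     << (to_dperm (std (take k s)), to_dperm (std (drop k s))) >>.

Definition hone : H := basisF dperm0.

Definition hmul (x y : H) : H :=
  \sum_(s <- msupp x) \sum_(t <- msupp y) (x@_s * y@_t) *: mulF s t.

Definition tensor (x y : H) : HH :=
  \sum_(s <- msupp x) \sum_(t <- msupp y) (x@_s * y@_t) *: << (s, t) >>.

Definition coproduct (x : H) : HH :=
  \sum_(s <- msupp x) x@_s *: coprodF s.

End HopfAlgebra.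

(* Leaves are left implicit: src e = None (resp. tgt e = None) means that the
   edge e, oriented upwards, starts at a down leaf (resp. ends at an up leaf)
   of its own. A strand is an edge with two leaves and no vertex. *)
Record digraph := Digraph {
  vertex : finType;
  edge : finType;
  label : vertex -> nat;
  src : edge -> option vertex;
  tgt : edge -> option vertex
}.

Section Digraph.
Variable T : digraph.
Implicit Types (v : vertex T) (e f : edge T) (g : {set edge T}).

Definition parent_edges v : {set edge T} := [set e | src e == Some v].
Definition child_edges v : {set edge T} := [set e | tgt e == Some v].

Definition decoration v : deco :=
  deco_of_bools (#|parent_edges v| == 2, #|child_edges v| == 2).

(* Undirected connectivity is that of the incidence graph, whose nodes are the
   vertices and the edges of T; linked X is connectivity once the nodes in X
   have been removed. *)
Notation node := (vertex T + edge T)%type.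

Definition incident (x y : node) : bool :=
  match x, y with
  | inl v, inr e | inr e, inl v => (src e == Some v) || (tgt e == Some v)
  | _, _ => false
  end.

Definition linked (X : {set node}) : rel node :=
  connect [rel x y | [&& incident x y, x \notin X & y \notin X]].

(* The ancestor or descendant subtree of v reached through the edge e at v. *)
Definition branch v e : {set vertex T} :=
  [set w | linked [set inl v] (inr e) (inl w)].

Definition left_right_edges v (A : {set edge T}) : Prop :=
  exists el er : edge T,
    [/\ A = [set el; er],
        forall w, w \in branch v el -> (label w < label v)%N
      & forall w, w \in branch v er -> (label v < label w)%N].

Record is_permutree : Prop := IsPermutree {
  permutree_label_inj : injective (@label T);
  permutree_label_bound : forall v, (1 <= label v <= #|vertex T|)%N;
  permutree_nonempty : (0 < #|edge T|)%N;
  permutree_connected : forall x y : node, linked set0 x y;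
  (* No cycle runs through e, loops and multiple edges included. *)
  permutree_acyclic : forall e v w, src e = Some v -> tgt e = Some w ->
    ~~ linked [set inr e] (inl v) (inl w);
  permutree_parents : forall v, #|parent_edges v| \in [:: 1; 2]%N;
  permutree_children : forall v, #|child_edges v| \in [:: 1; 2]%N;
  permutree_ancestors : forall v, #|parent_edges v| = 2 ->
    left_right_edges v (parent_edges v);
  permutree_descendants : forall v, #|child_edges v| = 2 ->
    left_right_edges v (child_edges v)
}.

Definition linear_extension (s : seq (vertex T)) : bool :=
  [forall e, forall v, forall w,
     (src e == Some v) ==> (tgt e == Some w) ==> (index v s < index w s)%N].

Definition vword (s : seq (vertex T)) : word :=
  [seq (label v, decoration v) | v <- s].

Definition basisP (K : fieldType) : {malg K[dperm]} :=
  \sum_(s <- permutations (enum (vertex T)) | linear_extension s)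
     basisF K (to_dperm (vword s)).

Definition up_step : rel (edge T) :=
  [rel e f | (tgt e != None) && (tgt e == src f)].

Definition geodesic (p : seq (edge T)) : bool :=
  if p is e :: q
  then [&& src e == None, path up_step e q & tgt (last e q) == None]
  else false.

Definition is_cut g : Prop :=
  forall p, geodesic p -> count (mem g) p = 1%N.

(* The edges of g lie on both sides: each is cut into a lower and an upper
   half. *)
Definition edge_below g e : bool := [exists f in g, connect up_step e f].
Definition edge_above g e : bool := [exists f in g, connect up_step f e].

Definition vertex_below g v : bool :=
  [exists e, (src e == Some v) && edge_below g e].
Definition vertex_above g v : bool :=
  [exists e, (tgt e == Some v) && edge_above g e].

Definition below g : digraph :=
  @Digraph {v | vertex_below g v} {e | edge_below g e}
    (fun u => label (val u))
    (fun x => obind insub (src (val x)))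
    (fun x => if val x \in g then None else obind insub (tgt (val x))).

Definition above g : digraph :=
  @Digraph {v | vertex_above g v} {e | edge_above g e}
    (fun u => label (val u))
    (fun x => if val x \in g then None else obind insub (src (val x)))
    (fun x => obind insub (tgt (val x))).

Definition component_tree (C : {set node}) : digraph :=
  @Digraph {v | inl v \in C} {e | inr e \in C}
    (fun u => #|[set w : {w | inl w \in C} | (label (val w) <= label (val u))%N]|)
    (fun x => obind insub (src (val x)))
    (fun x => obind insub (tgt (val x))).

Definition components : {set {set node}} :=
  equivalence_partition (linked set0) [set: node].

(* In the forests below and above a cut of a permutree, the label sets of two
   components that are not strands are separated by the label of a vertex on
   the other side of the cut, hence the largest label sorts the components
   from left to right. Strands (largest label 0) come first; they contribute
   the unit to products. *)
Definition max_label (C : {set node}) : nat := \max_(v | inl v \in C) label v.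

Definition trees : seq digraph :=
  [seq component_tree C
     | C <- sort (fun C D => max_label C <= max_label D)%N (enum components)].

Lemma is_dperm_vword (s : seq (vertex T)) :
  is_permutree -> s \in permutations (enum (vertex T)) -> is_dperm (vword s).
Proof.
move=> hT; rewrite mem_permutations => hs.
have us : uniq s by rewrite (perm_uniq hs) enum_uniq.
have hz : size s = #|vertex T| by rewrite (perm_size hs) -cardE.
have e : unzip1 (vword s) = [seq label v | v <- s]
  by rewrite /unzip1 /vword -map_comp.
have ul : uniq [seq label v | v <- s]
  by rewrite (map_inj_uniq (permutree_label_inj hT)).
rewrite /is_dperm e size_map; apply: perm_iota1; rewrite ?size_map //.
move=> _ /mapP[v _ ->]; rewrite hz.
exact: permutree_label_bound hT v.
Qed.

End Digraph.

Definition below_trees (S : digraph) (g : {set edge S}) : seq digraph :=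
  trees (below g).
Definition above_trees (S : digraph) (g : {set edge S}) : seq digraph :=
  trees (above g).

(* Main.v *)
Require Import Defs.
From mathcomp Require Import all_boot all_order all_algebra.
From mathcomp Require Import finmap.
From mathcomp.multinomials Require Import monalg.
From mathcomp Require Import boolp.

Set Implicit Arguments.
Unset Strict Implicit.
Unset Printing Implicit Defensive.

Import GRing.Theory.
Local Open Scope ring_scope.

(** A term of the coproduct of P_S is a linear extension of S together with a
    place where it is cut in two. The letters before that place form an order
    ideal I of S, and conversely a linear extension of I followed by one of the
    complement of I is a linear extension of S. Hence (coproduct_basisP) the
    coproduct is the sum over the order ideals I of L(I) (x) L(S - I), where
    L(J), written sumF, is the sum of the standardized linear extensions of the
    vertices in J. It remains to match ideals with cuts, and L(I), L(S - I) with
    the two products.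

    Cuts are the edge boundaries of order ideals (sum_ideals_cuts). Climbing a
    vertical path from a down leaf, counted in I, to an up leaf, counted
    outside, one leaves I across exactly one edge and never comes back; hence
    the edges leaving I form a cut. Conversely, a cut is determined by the set
    of vertices below it, because two of its edges are never on a common
    vertical path and every edge lies on a vertical path that meets it. The
    vertices below the cut obtained from I are those of I, because every edge
    is followed by a vertical path up to a leaf. Such paths exist because a
    tree has no directed cycle.

    For the products, two forests whose labels are separated have as joint
    linear extensions the shuffles of the linear extensions of each, which is
    the product (sumF_cat); by induction the product over the trees of a forest,
    sorted by labels, is L of the whole forest (prod_trees). So the geometric
    heart is that the components of I, and those of its complement, have
    separated labels (separation). Given two components of I, take the simple
    path of S joining them, and on it the vertex z that is highest for a
    numbering of S that increases upwards and in which I comes first. If z were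
    in I the whole path would be; so z is outside I, its two neighbours on the
    path are reached through two distinct children, and the two components lie
    in the left and right descendant subtrees of z. For the complement of I one
    reverses the numbering and argues with parents. *)

(** * Bilinearity of the operations *)

Section Linear.
Variables (K : fieldType) (D : choiceType) (M : lmodType K).
Implicit Types (f : D -> M) (x : {malg K[D]}).

Definition linext f x : M := \sum_(s <- msupp x) x@_s *: f s.

Lemma linextEw f x (d : {fset D}) : (msupp x `<=` d)%fset ->
  linext f x = \sum_(s <- d) x@_s *: f s.
Proof.
move=> xd; apply: big_fset_incl xd _ => s _ sx.
by rewrite mcoeff_outdom // scale0r.
Qed.

Lemma linextD f : {morph linext f : x y / x + y}.
Proof.
move=> x y; rewrite (linextEw f (msuppD_le x y)).
rewrite (linextEw f (fsubsetUl (msupp x) (msupp y))).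
rewrite (linextEw f (fsubsetUr (msupp x) (msupp y))) -big_split /=.
by apply: eq_bigr => s _; rewrite mcoeffD scalerDl.
Qed.

Lemma linext0 f : linext f 0 = 0.
Proof. by rewrite /linext msupp0 big_seq_fset0. Qed.

Lemma linextU f s : linext f << s >> = f s.
Proof.
by rewrite /linext msuppU oner_eq0 big_seq_fset1 mcoeffUU scale1r.
Qed.

Lemma linext_sum f (I : Type) (r : seq I) (P : pred I) (F : I -> D) :
  linext f (\sum_(i <- r | P i) << F i >>) = \sum_(i <- r | P i) f (F i).
Proof.
rewrite (big_morph _ (linextD f) (linext0 f)).
by apply: eq_bigr => i _; rewrite linextU.
Qed.

End Linear.

Section Operations.
Variable K : fieldType.
Variables (I J : Type) (r : seq I) (q : seq J) (P : pred I) (Q : pred J).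
Variables (F : I -> dperm) (G : J -> dperm).

(** The product and the tensor product are both given by the double sum on the
    left, which only involves the supports of x and y; the right-hand side
    evaluates it on sums of basis elements that may repeat. *)
Lemma bilinear_sum (M : lmodType K) (f : dperm -> dperm -> M)
    (x := \sum_(i <- r | P i) basisF K (F i))
    (y := \sum_(j <- q | Q j) basisF K (G j)) :
  \sum_(s <- msupp x) \sum_(t <- msupp y) (x@_s * y@_t) *: f s t =
  \sum_(i <- r | P i) \sum_(j <- q | Q j) f (F i) (G j).
Proof.
transitivity (linext (fun s => linext (f s) y) x).
  apply: eq_bigr => s _; rewrite /linext scaler_sumr.
  by apply: eq_bigr => t _; rewrite scalerA.
rewrite linext_sum; apply: eq_bigr => i _.
by rewrite linext_sum.
Qed.

Lemma hmul_sum :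
  hmul (\sum_(i <- r | P i) basisF K (F i)) (\sum_(j <- q | Q j) basisF K (G j))
  = \sum_(i <- r | P i) \sum_(j <- q | Q j) mulF K (F i) (G j).
Proof. exact: bilinear_sum. Qed.

Lemma tensor_sum :
  tensor (\sum_(i <- r | P i) basisF K (F i))
         (\sum_(j <- q | Q j) basisF K (G j))
  = \sum_(i <- r | P i) \sum_(j <- q | Q j) << (F i, G j) >>.
Proof. exact: bilinear_sum. Qed.

Lemma coproduct_sum :
  coproduct (\sum_(i <- r | P i) basisF K (F i)) =
  \sum_(i <- r | P i) coprodF K (F i).
Proof. exact: linext_sum. Qed.

End Operations.

(** * Shuffles as words with prescribed restrictions *)

Lemma shuffles_cons (T : Type) (x y : T) s t :
  shuffles (x :: s) (y :: t) =
  map (cons x) (shuffles s (y :: t)) ++ map (cons y) (shuffles (x :: s) t).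
Proof. by []. Qed.

Section Shuffles.
Variable T : eqType.
Implicit Types (a : pred T) (s t w : seq T).

Lemma shuffless0 s : shuffles s [::] = [:: s].
Proof. by case: s. Qed.

Lemma mem_shuffles_consl x s t w :
  w \in shuffles s t -> x :: w \in shuffles (x :: s) t.
Proof.
case: t => [|y t] ws /=; last by rewrite mem_cat map_f.
by move: ws; rewrite shuffless0 !inE => /eqP->.
Qed.

Lemma mem_shuffles_consr y s t w :
  w \in shuffles s t -> y :: w \in shuffles s (y :: t).
Proof.
case: s => [|x s] wt /=; last by rewrite mem_cat orbC map_f.
by case: t wt => [|z t]; rewrite !inE => /eqP->.
Qed.

Lemma mem_shuffles_filter a w :
  w \in shuffles (filter a w) (filter (predC a) w).
Proof.
elim: w => [|x w IH] //=; case: (a x) => /=.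
  exact: mem_shuffles_consl.
exact: mem_shuffles_consr.
Qed.

(** The two words can be read off a shuffle, so that distinct pairs of words
    have disjoint sets of shuffles. *)
Lemma filter_shuffles a s t w : all a s -> all (predC a) t ->
  w \in shuffles s t -> (filter a w = s) * (filter (predC a) w = t).
Proof.
have [as0 at0] : (forall s, all a s -> filter (predC a) s = [::])
    /\ (forall t, all (predC a) t -> filter a t = [::]).
  split=> r; elim: r => //= x r IH /andP[ax /IH ->]; first by rewrite ax.
  by rewrite (negPf ax).
elim: s t w => [|x s IHs] t w.
  move=> _ at_ wt; have -> : w = t.
    by case: t wt {at_} => [|y t]; rewrite inE => /eqP.
  by rewrite (at0 _ at_) (all_filterP at_).
move=> /[dup] axs /andP[ax as_]; elim: t w => [|y t IHt] w.
  by move=> _; rewrite inE => /eqP->; rewrite as0 //; move/all_filterP: axs.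
move=> /[dup] ayt /andP[/negPf ay at_]; rewrite shuffles_cons mem_cat.
case/orP=> /mapP[v vst ->]; rewrite /= ?ax ?ay /=.
  by have [-> ->] := IHs _ _ as_ ayt vst.
by have [-> ->] := IHt _ at_ vst.
Qed.

Lemma uniq_shuffles a s t :
  all a s -> all (predC a) t -> uniq (shuffles s t).
Proof.
elim: s t => [|x s IHs] t; first by case: t.
elim: t => [|y t IHt] // /[dup] axs /andP[ax as_] /[dup] ayt /andP[ay at_].
rewrite shuffles_cons cat_uniq !map_inj_uniq; try by move=> ? ? [].
rewrite IHs ?IHt //= andbT; apply/hasPn => _ /mapP[v _ ->].
by apply/negP=> /mapP[u _ [yx _]]; rewrite /= yx ax in ay.
Qed.

Lemma pairwise_shuffles (r : rel T) s t w :
  allrel r s t -> allrel r t s -> w \in shuffles s t ->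
  pairwise r w = pairwise r s && pairwise r t.
Proof.
elim: s t w => [|x s IHs] t w.
  by case: t => [|y t] _ _; rewrite inE => /eqP->.
elim: t w => [|y t IHt] w.
  by rewrite inE => _ _ /eqP->; rewrite andbT.
move=> rst rts; rewrite shuffles_cons mem_cat.
case/orP=> /mapP[v vst ->]; rewrite pairwise_cons.
  have := rst; rewrite allrel_consl => /andP[rx rst'].
  have := rts; rewrite allrel_consr => /andP[_ rts'].
  rewrite (IHs (y :: t)) // (perm_all _ (perm_shuffles vst)) all_cat rx andbT.
  by rewrite [pairwise r (x :: s)]pairwise_cons andbA.
have := rst; rewrite allrel_consr => /andP[_ rst'].
have := rts; rewrite allrel_consl => /andP[ry rts'].
rewrite IHt // (perm_all _ (perm_shuffles vst)) all_cat ry andTb.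
by rewrite [pairwise r (y :: t)]pairwise_cons andbCA.
Qed.

End Shuffles.

Lemma map_shuffles (T U : Type) (f : T -> U) s t :
  [seq map f w | w <- shuffles s t] = shuffles (map f s) (map f t).
Proof.
elim: s t => [|x s IHs] t; first by case: t.
elim: t => [|y t IHt] //; rewrite [map f (x :: s)]/= [map f (y :: t)]/=.
by rewrite !shuffles_cons map_cat -(IHs (y :: t)) -IHt -!map_comp.
Qed.

(** Blocks with distinct indices are disjoint, since g recovers the index. *)
Lemma uniq_flatten_map (T U : eqType) (f : T -> seq U) (g : U -> T)
    (s : seq T) :
  uniq s -> {in s, forall x, uniq (f x) /\ {in f x, forall w, g w = x}} ->
  uniq (flatten (map f s)).
Proof.
elim: s => //= x s IH /andP[xs /IH us] fs; rewrite cat_uniq.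
rewrite (fs x (mem_head _ _)).1 us ?andbT /=; last first.
  by move=> y ys; apply: fs; rewrite inE ys orbT.
apply/hasPn => w /flatten_mapP[y ys wy]; apply/negP=> /= wx.
have gx := (fs x (mem_head _ _)).2 w wx.
have gy : g w = y by apply: (fs y _).2 => //; rewrite inE ys orbT.
by move: xs; rewrite -gx gy ys.
Qed.

(** Restricting a word to A and to its complement is inverse to choosing a
    word on each part and a shuffle of the two. *)
Lemma perm_permutations_cat (T : eqType) (A B : seq T) : uniq (A ++ B) ->
  perm_eq (permutations (A ++ B))
    (flatten [seq flatten [seq shuffles s t | t <- permutations B]
             | s <- permutations A]).
Proof.
move=> uAB; have := uAB; rewrite cat_uniq => /and3P[uA /hasPn AB uB].
have allA s : perm_eq s A -> all (mem A) s.
  by move=> sA; apply/allP => x; rewrite (perm_mem sA).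
have allB t : perm_eq t B -> all (predC (mem A)) t.
  by move=> tB; apply/allP => x; rewrite (perm_mem tB) => /AB.
apply: uniq_perm; first exact: permutations_uniq.
  apply: (uniq_flatten_map (g := filter (mem A))).
    exact: permutations_uniq.
  move=> s; rewrite mem_permutations => /allA sA; split.
    apply: (uniq_flatten_map (g := filter (predC (mem A)))).
      exact: permutations_uniq.
    move=> t; rewrite mem_permutations => /allB tB.
    split; first exact: (@uniq_shuffles _ (mem A)).
    by move=> w /(filter_shuffles sA tB)[].
  move=> w /flatten_mapP[t]; rewrite mem_permutations => /allB tB.
  by case/(filter_shuffles sA tB).
have filterA : filter (mem A) (A ++ B) = A.
  rewrite filter_cat (all_filterP (allA A (perm_refl A))).
  suff -> : filter (mem A) B = [::] by rewrite cats0.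
  by apply/eqP; rewrite -[_ == _]negbK -has_filter; apply/hasPn.
have filterB : filter (predC (mem A)) (A ++ B) = B.
  rewrite filter_cat (all_filterP (allB B (perm_refl B))).
  suff -> : filter (predC (mem A)) A = [::] by [].
  apply/eqP; rewrite -[_ == _]negbK -has_filter; apply/hasPn => x xA.
  by rewrite /= negbK.
move=> w; rewrite mem_permutations; apply/idP/flatten_mapP.
  move=> wAB; exists (filter (mem A) w).
    by rewrite mem_permutations -{2}filterA perm_filter.
  apply/flatten_mapP; exists (filter (predC (mem A)) w).
    by rewrite mem_permutations -[X in perm_eq _ X]filterB perm_filter.
  exact: mem_shuffles_filter.
case=> s; rewrite mem_permutations => sA /flatten_mapP[t].
rewrite mem_permutations => tB /perm_shuffles w_st.
by apply: perm_trans w_st _; apply: perm_cat.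
Qed.

(** * Linear extensions of a labelled relation *)

Lemma to_dpermK (w : word) : is_dperm w -> to_dperm w = w :> word.
Proof. by move=> dw; rewrite /to_dperm insubdK. Qed.

Section LinearExtensions.
Variables (K : fieldType) (V : eqType) (r : rel V) (wt : V -> nat * deco).
Implicit Types (A B s t : seq V).

(** For duplicate-free words this is being a linear extension of r, in a form
    that can be evaluated on a concatenation or a shuffle letter by letter. *)
Definition topological s := pairwise [rel x y | ~~ r y x] s.

(** The element P of the forest induced on A. Standardizing the words makes it
    meaningful when the labels in A are not consecutive integers. *)
Definition sumF A : {malg K[dperm]} :=
  \sum_(s <- permutations A | topological s)
     basisF K (to_dperm (std (map wt s))).

Lemma perm_sumF A B : perm_eq A B -> sumF A = sumF B.
Proof. by move=> AB; apply/perm_big/perm_permutations. Qed.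

Lemma sumF_nil : sumF [::] = hone K.
Proof.
rewrite /sumF big_cons big_nil addr0 /hone; congr basisF.
by apply: val_inj; apply: to_dpermK.
Qed.

(** Since the labels of t exceed those of s, the standardization of s and the
    shifted standardization of t are the images of s and t under one and the
    same relabelling, the standardization of s ++ t; it commutes with
    shuffling. *)
Lemma mulF_std s t (lab := fun x => (wt x).1) :
  uniq (map lab (s ++ t)) -> allrel (fun x y => (lab x < lab y)%N) s t ->
  mulF K (to_dperm (std (map wt s))) (to_dperm (std (map wt t))) =
  \sum_(w <- shuffles s t) basisF K (to_dperm (std (map wt w))).
Proof.
move=> ust lt_st.
have dperm_std u : uniq (map lab u) -> is_dperm (std (map wt u)).
  by move=> ?; apply: is_dperm_std; rewrite /unzip1 -map_comp.
have [us ut] : uniq (map lab s) /\ uniq (map lab t).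
  by move: ust; rewrite map_cat cat_uniq => /and3P[].
rewrite /mulF !to_dpermK ?dperm_std //.
pose f x := (std_value (map wt (s ++ t)) (lab x), (wt x).2).
have -> : std (map wt s) = map f s.
  rewrite /std -map_comp; apply/eq_in_map => x xs; congr (_, _).
  rewrite /std_value map_cat count_cat [X in (_ + X)%N](_ : _ = 0%N) ?addn0 //.
  apply/eqP; rewrite -leqn0 leqNgt -has_count; apply/hasPn => _ /mapP[y yt ->].
  by rewrite /= -ltnNge; apply: (allrelP lt_st).
have -> : shift (size (map f s)) (std (map wt t)) = map f t.
  rewrite /shift /std -!map_comp; apply/eq_in_map => x xs; congr (_, _).
  rewrite /std_value /= map_cat count_cat; congr addn.
  rewrite size_map -(size_map wt); apply/esym/eqP; rewrite -all_count.
  by apply/allP => _ /mapP[y ys ->]; apply/ltnW/(allrelP lt_st).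
rewrite -map_shuffles big_map [LHS]big_seq [RHS]big_seq.
apply: eq_bigr => w /perm_shuffles w_st; congr (basisF K (to_dperm _)).
rewrite /std -map_comp; apply: eq_map => x; congr (_, _).
by apply/permP; rewrite perm_sym perm_map.
Qed.

(** Two forests placed side by side: their linear extensions are the shuffles of
    the linear extensions of each of them. *)
Lemma sumF_cat A B (lab := fun x => (wt x).1) : uniq (map lab (A ++ B)) ->
  allrel (fun x y => (lab x < lab y)%N) A B ->
  allrel (fun x y => ~~ r x y && ~~ r y x) A B ->
  sumF (A ++ B) = hmul (sumF A) (sumF B).
Proof.
move=> uAB ltAB rAB; rewrite hmul_sum {1}/sumF.
have /perm_permutations_cat pAB := map_uniq uAB.
rewrite big_mkcond (perm_big _ pAB) big_flatten big_map /=.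
rewrite [RHS]big_mkcond /= [LHS]big_seq [RHS]big_seq; apply: eq_bigr => s.
rewrite mem_permutations => sA; rewrite big_flatten big_map.
transitivity (\sum_(t <- permutations B | topological t)
  if topological s then \sum_(w <- shuffles s t)
     basisF K (to_dperm (std (map wt w))) else 0).
  rewrite [RHS]big_mkcond [LHS]big_seq [RHS]big_seq; apply: eq_bigr => t.
  rewrite mem_permutations => tB.
  have topE w : w \in shuffles s t ->
      topological w = topological s && topological t.
    move=> wst; apply: pairwise_shuffles => //.
      apply/allrelP => x y; rewrite (perm_mem sA) (perm_mem tB) => xA yB.
      by have /andP[] := allrelP rAB x y xA yB.
    apply/allrelP => x y; rewrite (perm_mem sA) (perm_mem tB) => xA yB.
    by have /andP[] := allrelP rAB y x yB xA.
  rewrite big_seq (eq_bigr (fun w => if topological s && topological t then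
     basisF K (to_dperm (std (map wt w))) else 0)) => [|w /topE ->] //.
  case: (topological s); case: (topological t); rewrite /= -?big_seq //;
    exact: big1.
case: (topological s); last exact: big1.
rewrite [LHS]big_seq_cond [RHS]big_seq_cond; apply: eq_bigr => t /andP[].
rewrite mem_permutations => tB _; rewrite mulF_std //.
  by rewrite (perm_uniq (perm_map _ (perm_cat sA tB))).
apply/allrelP => x y; rewrite (perm_mem sA) (perm_mem tB).
exact: (allrelP ltAB).
Qed.

End LinearExtensions.

Lemma perm_permutations_map (T U : eqType) (f : T -> U) (s : seq T) :
  injective f ->
  perm_eq (permutations (map f s)) [seq map f t | t <- permutations s].
Proof.
move=> inj_f; apply: uniq_perm; first exact: permutations_uniq.
  by rewrite map_inj_uniq ?permutations_uniq //; apply: inj_map.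
move=> w; rewrite mem_permutations; apply/idP/mapP => [ws|[t]]; last first.
  by rewrite mem_permutations => ts ->; apply: perm_map.
have [t wE] : exists t, w = map f t.
  have : {subset w <= map f s} by move=> x; rewrite (perm_mem ws).
  elim: w {ws} => [|x w IH] xws; first by exists [::].
  have [t ->] : exists t, w = map f t.
    by apply: IH => y yw; apply: xws; rewrite inE yw orbT.
  by have /mapP[y _ ->] := xws x (mem_head _ _); exists (y :: t).
exists t => //; rewrite mem_permutations.
by apply: (perm_map_inj inj_f); rewrite -wE.
Qed.

Lemma sumF_map (K : fieldType) (T U : eqType) (f : T -> U) (r : rel U)
    (wt : U -> nat * deco) (A : seq T) : injective f ->
  sumF K r wt (map f A) = sumF K (relpre f r) (wt \o f) A.
Proof.
move=> inj_f; rewrite /sumF (perm_big _ (perm_permutations_map A inj_f)) /=.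
rewrite big_map; apply: eq_big => [s|s _]; first exact: pairwise_map.
by rewrite -map_comp.
Qed.

(** * Connectivity in digraphs *)

Lemma connect_morph (T U : finType) (r : rel T) (q : rel U) (f : T -> U) :
  (forall x y, r x y -> connect q (f x) (f y)) ->
  forall x y, connect r x y -> connect q (f x) (f y).
Proof.
move=> rq x y /connectP[p + ->]; elim: p x => //= z p IH x /andP[/rq xz /IH].
exact: connect_trans xz.
Qed.

Section Adjacency.
Variable G : digraph.
Implicit Types (u v : vertex G) (e : edge G).
Local Notation node := (vertex G + edge G)%type.
Implicit Types X : {set node}.

Definition arc : rel (vertex G) :=
  [rel u v | [exists e, (src e == Some u) && (tgt e == Some v)]].

Definition adjacent : rel (vertex G) := [rel u v | arc u v || arc v u].

Definition letter v : nat * deco := (label v, decoration v).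

Lemma arcP u v :
  reflect (exists2 e, src e = Some u & tgt e = Some v) (arc u v).
Proof.
apply: (iffP existsP) => [[e /andP[/eqP ? /eqP ?]]|[e /eqP eu /eqP ev]].
  by exists e.
by exists e; rewrite eu.
Qed.

Lemma adjacentC : symmetric adjacent.
Proof. by move=> u v; apply: orbC. Qed.

Lemma incidentC : symmetric (@incident G).
Proof. by case=> [?|?] [?|?]. Qed.

Lemma linked_trans X : transitive (linked X).
Proof. exact: connect_trans. Qed.

Lemma linked_sym X : symmetric (linked X).
Proof.
apply: sym_connect_sym => x y.
by rewrite /= incidentC [X in _ && X]andbC.
Qed.

Lemma linked1 X x y :
  incident x y -> x \notin X -> y \notin X -> linked X x y.
Proof. by move=> xy xX yX; apply: connect1; rewrite /= xy xX. Qed.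

Lemma linked_arc X e u v : src e = Some u -> tgt e = Some v ->
  inl u \notin X -> inl v \notin X -> inr e \notin X ->
  linked X (inl u) (inl v).
Proof.
move=> eu ev uX vX eX; apply: (@linked_trans _ (inr e)).
  by apply: linked1; rewrite //= eu eqxx.
by apply: linked1; rewrite //= ev eqxx orbT.
Qed.

(** An edge is incident to its source and to its target only, so a walk in the
    incidence graph goes from vertex to vertex along arcs. *)
Lemma linked0E u v : linked set0 (inl u) (inl v) = connect adjacent u v.
Proof.
apply/idP/idP; last first.
  have arc_linked a b : arc a b -> linked set0 (inl a : node) (inl b).
    by case/arcP=> e ea eb; apply: linked_arc ea eb _ _ _; rewrite inE.
  apply: (@connect_morph _ _ adjacent _ inl) => a b /orP[] /arc_linked //.
  by rewrite linked_sym.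
pose reached (x : node) : Prop := match x with
  | inl w => connect adjacent u w
  | inr e => forall w, incident (inl w) (inr e) -> connect adjacent u w
  end.
suff reach (x y : node) : linked set0 x y -> reached x -> reached y.
  by move/reach; apply; apply: connect0.
case/connectP=> p + ->; elim: p x => //= z p IH x /andP[/and3P[xz _ _] zp] ux.
apply: IH zp _; case: x z xz ux => [a|e] [b|f] //=.
  2: by move=> + ux; apply: ux.
move=> af ua b bf; have [<-//|ab] := eqVneq a b.
apply: connect_trans ua (connect1 _); apply/orP.
case/orP: af => /eqP af; case/orP: bf => /eqP bf.
- by move: ab; rewrite af in bf; case: bf => ->; rewrite eqxx.
- by left; apply/arcP; exists f.
- by right; apply/arcP; exists f.
- by move: ab; rewrite af in bf; case: bf => ->; rewrite eqxx.
Qed.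

Lemma linear_extensionE (s : seq (vertex G)) : irreflexive arc ->
  perm_eq s (enum (vertex G)) -> linear_extension s = topological arc s.
Proof.
move=> arc_irr s_enum.
have us : uniq s by rewrite (perm_uniq s_enum) enum_uniq.
have sV v : v \in s by rewrite (perm_mem s_enum) mem_enum.
apply/idP/idP => [/forallP ext|top].
  case: (posnP (size s)) => [/size0nil->//|s_gt0].
  have x0 : vertex G by case: (s) s_gt0.
  apply/(pairwiseP x0) => i j ilt jlt ij; apply/negP => /arcP[e ej ei].
  move: (ext e) => /forallP/(_ (nth x0 s j))/forallP/(_ (nth x0 s i)).
  by rewrite ej ei !eqxx !index_uniq // ltnNge (ltnW ij).
apply/forallP => e; apply/forallP => v; apply/forallP => w.
apply/implyP => /eqP ev; apply/implyP => /eqP ew.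
have vw : arc v w by apply/arcP; exists e.
rewrite ltnNge leq_eqVlt; apply/negP => /orP[/eqP|] wv.
  move: vw; rewrite -(nth_index v (sV v)) -wv (nth_index v (sV w)).
  by rewrite arc_irr.
move/(pairwiseP v): top => /(_ _ _ _ _ wv); rewrite !inE !index_mem /=.
by move=> /(_ (sV w) (sV v)); rewrite !nth_index // vw.
Qed.

End Adjacency.

(** * The forest of a digraph *)

Lemma card_val_set (T : finType) (P : pred T) (A : {set {x | P x}})
    (B : {set T}) :
  (forall x, (x \in A) = (val x \in B)) -> {in B, forall y, P y} ->
  #|A| = #|B|.
Proof.
move=> AB BP; rewrite -(card_imset _ val_inj); apply: eq_card => y.
apply/imsetP/idP => [[x xA ->]|yB]; first by rewrite -AB.
by exists (Sub y (BP y yB)); rewrite ?AB SubK.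
Qed.

Lemma obind_insub (T : eqType) (P : pred T) (o : option T) (u : {x | P x}) :
  (obind insub o == Some u) = (o == Some (val u)).
Proof.
case: o => [x|] //=; apply/eqP/eqP => [|[->]]; last by rewrite valK.
by case: insubP => // v _ <- [->].
Qed.

Lemma perm_val_enum (T : finType) (P : pred T) :
  perm_eq (map val (enum {: {x | P x}})) (filter P (enum T)).
Proof.
apply: uniq_perm => [||x].
- by rewrite map_inj_uniq ?enum_uniq //; apply: val_inj.
- exact/filter_uniq/enum_uniq.
rewrite mem_filter mem_enum andbT; apply/mapP/idP => [[y _ ->]|Px].
  exact: valP.
by exists (Sub x Px); rewrite ?mem_enum ?SubK.
Qed.

Section Forest.
Variables (K : fieldType) (G : digraph).
Local Notation node := (vertex G + edge G)%type.
Implicit Types (C D : {set node}).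
Hypothesis label_inj : injective (@label G).
Hypothesis arc_irr : irreflexive (@arc G).

Definition verts C : seq (vertex G) :=
  [seq v <- enum (vertex G) | inl v \in C].

Lemma mem_verts C v : (v \in verts C) = (inl v \in C).
Proof. by rewrite mem_filter mem_enum andbT. Qed.

(** A set of nodes closed under incidence contains all the edges at its
    vertices, so decorations do not change; and the rank of a label inside the
    component is its standardization. *)
Lemma basisP_component_tree C :
  (forall v e, incident (inl v) (inr e) -> (inl v \in C) = (inr e \in C)) ->
  basisP (component_tree C) K = sumF K (@arc G) (@letter G) (verts C).
Proof.
move=> clC; pose T := component_tree C.
rewrite -(perm_sumF _ _ _ (perm_val_enum _)) sumF_map; last exact: val_inj.
have arcE : @arc T =2 relpre val (@arc G).
  move=> u v; apply/arcP/arcP => [[e eu ev]|[e eu ev]].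
    exists (val e); apply/eqP; rewrite -obind_insub; exact/eqP.
  have eC : inr e \in C by rewrite -(clC (val u)) ?(valP u) //= eu eqxx.
  by exists (Sub e eC); apply/eqP; rewrite obind_insub SubK ?eu ?ev.
have arcT_irr : irreflexive (@arc T) by move=> u; rewrite arcE /= arc_irr.
rewrite /basisP /sumF [LHS]big_seq_cond [RHS]big_seq_cond.
apply: eq_big => [s|s /andP[]]; rewrite mem_permutations.
  case: (boolP (perm_eq _ _)) => //= s_enum.
  rewrite linear_extensionE //; apply: eq_pairwise => u v /=.
  by rewrite arcE.
move=> s_enum _; congr (basisF K (to_dperm _)).
rewrite /std -map_comp; apply: eq_map => u; congr (_, _).
  rewrite /= /std_value count_map (permP s_enum) enumT cardsE cardE.
  by rewrite /enum_mem size_filter.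
rewrite /= /decoration; congr (deco_of_bools (_ == 2%N, _ == 2%N));
  apply: card_val_set => e.
- by rewrite !inE obind_insub.
- by rewrite inE => eu; rewrite -(clC (val u)) ?(valP u) //= eu.
- by rewrite !inE obind_insub.
- by rewrite inE => eu; rewrite -(clC (val u)) ?(valP u) //= eu orbT.
Qed.

Lemma mem_component C x y :
  C \in components G -> x \in C -> (y \in C) = linked set0 x y.
Proof.
case/imsetP=> z _ ->; rewrite !inE /= => zx; apply/idP/idP => zy.
  by apply: linked_trans zy; rewrite linked_sym.
exact: linked_trans zx zy.
Qed.

Hypothesis separated : forall u v, ~~ connect (@adjacent G) u v ->
  (forall u' v', connect (@adjacent G) u u' -> connect (@adjacent G) v v' ->
     label u' < label v')%N \/
  (forall u' v', connect (@adjacent G) u u' -> connect (@adjacent G) v v' ->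
     label v' < label u')%N.

(** As the label ranges of C and D do not overlap, comparing their largest labels
    tells which one is on the left. *)
Lemma component_lt C D u v : C \in components G -> D \in components G ->
  C != D -> (max_label C <= max_label D)%N ->
  inl u \in C -> inl v \in D -> (label u < label v)%N.
Proof.
move=> hC hD CD max_le uC vD.
have : ~~ connect (@adjacent G) u v.
  rewrite -linked0E -(mem_component _ hC uC); apply: contra CD => vC.
  apply/eqP/setP => x.
  by rewrite (mem_component x hC vC) (mem_component x hD vD).
case/separated => [|lt]; first by apply; apply: connect0.
have [w wD wmax] : exists2 w, inl w \in D & max_label D = label w.
  have [|w] := @eq_bigmax_cond _ (fun w => inl w \in D) (@label G).
    by apply/card_gt0P; exists v.
  by exists w.
have : (label w < label u)%N.
  by apply: lt; rewrite ?connect0 // -linked0E -(mem_component _ hD vD).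
rewrite ltnNge -wmax => /negP[]; apply: leq_trans max_le.
by rewrite /max_label (bigmax_sup u).
Qed.

Lemma prod_components (cs : seq {set node}) :
  uniq cs -> {subset cs <= components G} ->
  pairwise (fun C D => max_label C <= max_label D)%N cs ->
  uniq (map (@label G) (flatten (map verts cs))) /\
  \big[@hmul K/hone K]_(C <- cs) basisP (component_tree C) K =
  sumF K (@arc G) (@letter G) (flatten (map verts cs)).
Proof.
elim: cs => [|C cs IH]; first by rewrite big_nil sumF_nil.
rewrite pairwise_cons => /andP[Ccs ucs] sub_cs /andP[/allP maxC max_cs].
have hC : C \in components G by apply: sub_cs; rewrite mem_head.
have hcs D : D \in cs -> D \in components G.
  by move=> Dcs; apply: sub_cs; rewrite inE Dcs orbT.
have {IH} [ulab prod_cs] := IH ucs hcs max_cs.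
have lt_lab : allrel (fun u v => label u < label v)%N
    (verts C) (flatten (map verts cs)).
  apply/allrelP => u v; rewrite mem_verts => uC /flatten_mapP[D Dcs].
  rewrite mem_verts => vD; apply: (component_lt hC (hcs D Dcs)) uC vD.
    by apply: contraNneq Ccs => ->.
  exact: maxC.
have uniq_lab : uniq (map (@label G) (verts C ++ flatten (map verts cs))).
  rewrite map_cat cat_uniq ulab map_inj_uniq // filter_uniq ?enum_uniq //=.
  rewrite andbT; apply/hasPn => _ /mapP[v vcs ->]; apply/negP => /mapP[u uC].
  by move=> e; have := allrelP lt_lab u v uC vcs; rewrite e ltnn.
split; first exact: uniq_lab.
rewrite big_cons prod_cs basisP_component_tree; last first.
  move=> v e ve; apply/idP/idP => /(mem_component _ hC) ->.
    by apply: linked1; rewrite ?inE.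
  by apply: linked1; rewrite ?inE // incidentC.
rewrite [RHS]sumF_cat //.
apply/allrelP => u v; rewrite mem_verts => uC /flatten_mapP[D Dcs].
rewrite mem_verts => vD; rewrite -negb_or.
apply: contra Ccs => uv; suff <- : D = C by [].
have /(connect1 (e := @adjacent G)) : adjacent u v by [].
rewrite -linked0E -(mem_component _ hC uC) => vC.
apply/setP => x.
by rewrite (mem_component x hC vC) (mem_component x (hcs D Dcs) vD).
Qed.

Lemma prod_trees :
  \big[@hmul K/hone K]_(T <- trees G) basisP T K =
  sumF K (@arc G) (@letter G) (enum (vertex G)).
Proof.
rewrite /trees big_map.
set le := (fun C D => _); set cs := sort le (enum (components G)).
have le_total : total le by move=> C D; apply: leq_total.
have le_trans : transitive le by move=> C D E; apply: leq_trans.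
have [|||ulab ->] := @prod_components cs.
- by rewrite sort_uniq enum_uniq.
- by move=> C; rewrite mem_sort mem_enum.
- by rewrite -sorted_pairwise // sort_sorted.
apply: perm_sumF; apply: uniq_perm; rewrite ?enum_uniq ?(map_uniq ulab) // => v.
rewrite mem_enum; apply/flatten_mapP.
exists [set y in [set: node] | linked set0 (inl v) y].
  by rewrite mem_sort mem_enum; apply: imset_f; rewrite inE.
by rewrite mem_verts !inE /= /linked connect0.
Qed.

End Forest.

(** * Splitting linear extensions along order ideals *)

(** A word cut after k letters is determined by the set I of these letters and
    by the two pieces. *)
Lemma sum_cut_words (V : finType) (M : nmodType) (E : seq V -> seq V -> M) :
  \sum_(s <- permutations (enum V)) \sum_(k < (size s).+1)
     E (take k s) (drop k s) =
  \sum_(I : {set V}) \sum_(u <- permutations (enum I))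
     \sum_(v <- permutations (enum (~: I))) E u v.
Proof.
pose cuts := flatten [seq [seq (take k s, drop k s) | k <- iota 0 (size s).+1]
                     | s <- permutations (enum V)].
pose pairs := flatten [seq flatten [seq [seq (u, v)
    | v <- permutations (enum (~: J))] | u <- permutations (enum J)]
  | J <- enum {: {set V}}].
transitivity (\sum_(p <- cuts) E p.1 p.2).
  rewrite /cuts big_flatten big_map; apply: eq_bigr => s _.
  by rewrite big_map -(big_mkord xpredT (fun k => E (take k s) (drop k s))).
transitivity (\sum_(p <- pairs) E p.1 p.2); last first.
  rewrite /pairs big_flatten big_map big_enum; apply: eq_bigr => I _.
  rewrite big_flatten big_map; apply: eq_bigr => u _.
  by rewrite big_map.
apply/perm_big/uniq_perm.
- apply: (uniq_flatten_map (g := fun p => p.1 ++ p.2)).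
    exact: permutations_uniq.
  move=> s _; split=> [|_ /mapP[k _ ->]]; last exact: cat_take_drop.
  rewrite map_inj_in_uniq ?iota_uniq // => j k.
  rewrite !mem_iota /= !add0n !ltnS => js ks [/(congr1 size) + _].
  by rewrite !size_takel.
- apply: (uniq_flatten_map (g := fun p : seq V * seq V => [set x in p.1])).
    exact: enum_uniq.
  move=> I _; split; last first.
    move=> _ /flatten_mapP[u uI /mapP[v _ ->]] /=; apply/setP => x.
    by move: uI; rewrite mem_permutations inE => /perm_mem->; rewrite mem_enum.
  apply: (uniq_flatten_map (g := fst)); first exact: permutations_uniq.
  move=> u _; split; last by move=> _ /mapP[v _ ->].
  by rewrite map_inj_uniq ?permutations_uniq // => v w [].
case=> u v; apply/flatten_mapP/flatten_mapP => [[s]|[I _ /flatten_mapP[w]]].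
  rewrite mem_permutations => s_enum /mapP[k _ uv].
  have {uv k} sE : s = u ++ v by case: uv => -> ->; rewrite cat_take_drop.
  have := enum_uniq V; rewrite -(perm_uniq s_enum) sE cat_uniq.
  case/and3P=> uu /hasPn vu uv; exists [set x in u]; first exact: mem_enum.
  apply/flatten_mapP; exists u; last apply: map_f; rewrite mem_permutations.
    by apply: uniq_perm; rewrite ?enum_uniq // => x; rewrite mem_enum inE.
  apply: uniq_perm; rewrite ?enum_uniq // => x; rewrite mem_enum !inE.
  apply/idP/idP => [/vu //|xu].
  have : x \in s by rewrite (perm_mem s_enum) mem_enum.
  by rewrite sE mem_cat (negPf xu).
rewrite mem_permutations => wI /mapP[t]; rewrite mem_permutations => tI [-> ->].
exists (w ++ t); last first.
  apply/mapP; exists (size w); last by rewrite take_size_cat ?drop_size_cat //.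
  by rewrite mem_iota ltnS size_cat leq_addr.
rewrite mem_permutations; apply: (perm_trans (perm_cat wI tI)).
apply: uniq_perm => [||x]; last by rewrite mem_cat !mem_enum inE orbN.
  rewrite cat_uniq !enum_uniq andbT; apply/hasPn => x.
  by rewrite /= !mem_enum inE.
exact: enum_uniq.
Qed.

Section Ideals.
Variables (K : fieldType) (S : digraph).
Hypothesis hS : is_permutree S.
Hypothesis arc_irr : irreflexive (@arc S).
Implicit Type I : {set vertex S}.

Definition order_ideal I : bool :=
  [forall u, forall v, arc u v ==> (v \in I) ==> (u \in I)].

Lemma order_idealP I :
  reflect (forall u v, arc u v -> v \in I -> u \in I) (order_ideal I).
Proof.
apply: (iffP forallP) => [h u v uv vI|h u].
  by move: (h u) => /forallP/(_ v); rewrite uv vI.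
by apply/forallP => v; apply/implyP => uv; apply/implyP; apply: h.
Qed.

Local Notation sumF := (sumF K (@arc S) (@letter S)).

(** A concatenation u ++ v is a linear extension exactly when u and v are and no
    arc goes from the letters of v to those of u, that is, when the letters of u
    form an order ideal. *)
Lemma coproduct_basisP :
  coproduct (basisP S K) =
  \sum_(I | order_ideal I) tensor (sumF (enum I)) (sumF (enum (~: I))).
Proof.
rewrite coproduct_sum.
pose F (s : seq (vertex S)) := to_dperm (std (map (@letter S) s)).
pose E s t : {malg K[(dperm * dperm)%type]} :=
  if topological (@arc S) (s ++ t) then << (F s, F t) >> else 0.
transitivity (\sum_(s <- permutations (enum (vertex S)))
                 \sum_(k < (size s).+1) E (take k s) (drop k s)).
  rewrite big_mkcond [LHS]big_seq [RHS]big_seq; apply: eq_bigr => s s_perm.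
  rewrite linear_extensionE -?mem_permutations // /E.
  under [RHS]eq_bigr do rewrite cat_take_drop.
  case: ifP => _; last by rewrite big1.
  rewrite /coprodF to_dpermK; last exact: is_dperm_vword.
  rewrite size_map; apply: eq_bigr => k _.
  by rewrite /F map_take map_drop.
rewrite sum_cut_words [RHS]big_mkcond; apply: eq_bigr => I _.
rewrite tensor_sum.
have arcI u v : u \in permutations (enum I) ->
    v \in permutations (enum (~: I)) ->
    topological (@arc S) (u ++ v) =
    [&& order_ideal I, topological (@arc S) u & topological (@arc S) v].
  rewrite !mem_permutations => uI vI; rewrite /topological pairwise_cat.
  congr andb; apply/allrelP/order_idealP => [h x y xy yI|h x y].
    rewrite -[_ \in _]negbK; apply/negP => xI.
    have := h y x; rewrite (perm_mem uI) (perm_mem vI) !mem_enum inE /= xy.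
    by move=> /(_ yI xI).
  rewrite (perm_mem uI) (perm_mem vI) !mem_enum inE => xI yI.
  by apply/negP => /h /(_ xI); apply/negP.
case: ifP => idI; last first.
  rewrite big_seq big1 // => u uI; rewrite big_seq big1 // => v vI.
  by rewrite /E arcI // idI.
rewrite [RHS]big_mkcond [LHS]big_seq [RHS]big_seq; apply: eq_bigr => u uI.
transitivity (\sum_(v <- permutations (enum (~: I)))
  if topological (@arc S) u && topological (@arc S) v
  then << (F u, F v) >> else 0 : {malg K[(dperm * dperm)%type]}).
  rewrite [LHS]big_seq [RHS]big_seq; apply: eq_bigr => v vI.
  by rewrite /E arcI // idI.
case: (topological _ u); last by rewrite big1.
by rewrite [RHS]big_mkcond.
Qed.

End Ideals.

(** * Cuts and order ideals *)

Section Cuts.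
Variable S : digraph.
Hypothesis hS : is_permutree S.
Implicit Types (u v w : vertex S) (e f : edge S) (g : {set edge S}).
Implicit Types (I : {set vertex S}).

(** A directed walk from v to u, stopped when it first reaches u, does not
    traverse any edge that starts at u; with an edge e from u to v it would
    close a cycle through e. *)
Lemma arc_acyclic u v : arc u v -> ~~ connect (@arc S) v u.
Proof.
case/arcP=> e eu ev; have := permutree_acyclic hS eu ev; rewrite linked_sym.
apply: contra; case/connectP=> p; elim: p v {ev} => [|z p IH] v /=.
  by move=> _ ->; apply: connect0.
case/andP=> /arcP[f fv fz] zp up.
have [->|vu] := eqVneq v u; first exact: connect0.
apply: linked_trans (IH z zp up); apply: (linked_arc fv fz); rewrite inE //.
by apply: contraNneq vu => -[fe]; move: fv; rewrite fe eu => -[->].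
Qed.

Lemma arc_irreflexive : irreflexive (@arc S).
Proof.
move=> u; have [uu|/negPf //] := boolP (arc u u).
by have := arc_acyclic uu; rewrite connect0.
Qed.

(** A numbering of the vertices that increases along arcs. *)
Definition height v := #|[set u | connect (@arc S) u v]|.

Lemma height_lt u v : arc u v -> (height u < height v)%N.
Proof.
move=> uv; apply/proper_card/properP; split.
  apply/subsetP => w; rewrite !inE => wu.
  exact: connect_trans wu (connect1 uv).
by exists v; rewrite !inE ?connect0 // arc_acyclic.
Qed.

Lemma height_gt0 v : (0 < height v)%N.
Proof. by apply/card_gt0P; exists v; rewrite inE connect0. Qed.

Lemma parent_edge v : exists e, src e = Some v.
Proof.
have := permutree_parents hS v; have [->//|[e]] := set_0Vmem (parent_edges v).
  by rewrite cards0.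
by rewrite inE => /eqP ev; exists e.
Qed.

Lemma child_edge v : exists e, tgt e = Some v.
Proof.
have := permutree_children hS v; have [->//|[e]] := set_0Vmem (child_edges v).
  by rewrite cards0.
by rewrite inE => /eqP ev; exists e.
Qed.

Lemma up_stepE e f v : tgt e = Some v -> src f = Some v -> up_step e f.
Proof. by move=> ev fv; rewrite /up_step /= ev fv eqxx. Qed.

(** The target rises strictly along up_step, so a vertical path can be
    prolonged only finitely often; it stops at a leaf because each vertex has a
    parent. *)
Lemma climb e : exists2 q, path (@up_step S) e q & tgt (last e q) = None.
Proof.
pose m e := if tgt e is Some w then (#|vertex S|.+1 - height w)%N else 0%N.
have [n] := ubnP (m e); elim: n e => // n IH e; rewrite ltnS => le_n.
case te: (tgt e) => [w|]; last by exists [::].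
have [f fw] := parent_edge w; have ef := up_stepE te fw.
have lt_m : (m f < m e)%N.
  rewrite /m te; case tf: (tgt f) => [x|].
    apply: ltn_sub2l; first by rewrite ltnS max_card.
    by apply: height_lt; apply/arcP; exists f.
  by rewrite subn_gt0 ltnS max_card.
have [q fq q0] := IH f (leq_trans lt_m le_n).
by exists (f :: q); rewrite //= -/(up_step _ _) ef.
Qed.

Lemma descend e : exists s q,
  [/\ src s = None, path (@up_step S) s q & last s q = e].
Proof.
pose m e := if src e is Some w then height w else 0%N.
have [n] := ubnP (m e); elim: n e => // n IH e; rewrite ltnS => le_n.
case se: (src e) => [w|]; last by exists e, [::].
have [f fw] := child_edge w; have fe := up_stepE fw se.
have lt_m : (m f < m e)%N.
  rewrite /m se; case sf: (src f) => [x|]; last exact: height_gt0.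
  by apply: height_lt; apply/arcP; exists f.
have [s [q [s0 sq qf]]] := IH f (leq_trans lt_m le_n).
by exists s, (rcons q e); rewrite rcons_path last_rcons sq qf.
Qed.

(** Otherwise a geodesic through f, then e, then f' would meet the cut twice. *)
Lemma cut_antichain g f e f' : is_cut g ->
  f \in g -> up_step f e -> connect (@up_step S) e f' -> f' \notin g.
Proof.
move=> cut_g fg fe /connectP[q eq ->]; apply/negP => f'g.
have [s [p [s0 sp pf]]] := descend f; have [r er r0] := climb (last e q).
have /cut_g : geodesic (s :: p ++ e :: q ++ r).
  rewrite /geodesic s0 last_cat /= last_cat r0 cat_path sp pf /= cat_path eq er.
  by rewrite fe.
apply/eqP; rewrite -cat_cons count_cat -cat_cons count_cat neq_ltn.
apply/orP; right.
have s1 : (0 < count (mem g) (s :: p))%N.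
  by rewrite -has_count; apply/hasP; exists f; rewrite // -pf mem_last.
have e1 : (0 < count (mem g) (e :: q))%N.
  by rewrite -has_count; apply/hasP; exists (last e q); rewrite // mem_last.
by rewrite -addn1 leq_add // ltn_addr.
Qed.

(** Every edge lies on a geodesic, which meets the cut. *)
Lemma cut_meets g e : is_cut g ->
  exists2 f, f \in g & connect (@up_step S) e f || connect (@up_step S) f e.
Proof.
move=> cut_g; have [s [p [s0 sp pe]]] := descend e; have [r er r0] := climb e.
have /cut_g gp : geodesic (s :: p ++ r).
  by rewrite /= s0 last_cat pe r0 cat_path sp pe er.
have /hasP[f + fg] : has (mem g) (s :: p ++ r) by rewrite has_count gp.
rewrite -cat_cons mem_cat => /orP[|] fin; exists f; rewrite //; apply/orP.
  right; rewrite -pe; case/splitPl: fin sp => p1 p2 <-.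
  rewrite cat_path last_cat.
  by case/andP=> _ p2P; apply/connectP; exists p2.
by left; apply: (path_connect er); rewrite inE fin orbT.
Qed.

(** Down leaves count as members of I, and up leaves as non-members. *)
Definition starts_in I e := if src e is Some v then v \in I else true.
Definition ends_in I e := if tgt e is Some v then v \in I else false.
Definition cut_of I : {set edge S} := [set e | starts_in I e && ~~ ends_in I e].

Lemma starts_in_step I e f : up_step e f -> starts_in I f = ends_in I e.
Proof.
by rewrite /starts_in /ends_in /=; case/andP=> + /eqP<-; case: (tgt e).
Qed.

Lemma ends_starts_in I e : order_ideal I -> ends_in I e -> starts_in I e.
Proof.
move=> /order_idealP idI; rewrite /starts_in /ends_in.
case te: (tgt e) => [w|] //; case se: (src e) => [v|] // wI.
by apply: idI wI; apply/arcP; exists e.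
Qed.

Lemma above_cut_of I e f : order_ideal I -> connect (@up_step S) e f ->
  ~~ starts_in I e -> ~~ starts_in I f.
Proof.
move=> idI /connectP[q + ->]; elim: q e => //= f' q IH e /andP[ef f'q] eI.
apply: IH f'q _; rewrite (starts_in_step I ef).
by apply: contra eI; apply: ends_starts_in.
Qed.

(** Along a vertical path starts_in can only turn from true to false. If it
    holds at first, it either turns on the way or still holds on the last edge,
    which ends at an up leaf; the last edge where it holds is then the only one
    in the cut. *)
Lemma count_cut_of I e q : order_ideal I ->
  path (@up_step S) e q -> tgt (last e q) = None ->
  count (mem (cut_of I)) (e :: q) = starts_in I e.
Proof.
move=> idI; elim: q e => [|f q IH] e.
  by rewrite /= addn0 inE /ends_in => _ ->; rewrite andbT.
move=> /= /andP[ef fq] q0; have /= -> := IH f fq q0.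
rewrite (starts_in_step I ef) inE; have := @ends_starts_in I e idI.
by case: (ends_in I e) => [->|] //; rewrite andbT addn0.
Qed.

Lemma is_cut_cut_of I : order_ideal I -> is_cut (cut_of I).
Proof.
move=> idI [|e q] // /and3P[/eqP se eq /eqP q0].
by rewrite count_cut_of // /starts_in se.
Qed.

Lemma vertex_belowP g v :
  reflect (exists e f, [/\ src e = Some v, f \in g & connect (@up_step S) e f])
          (vertex_below g v).
Proof.
apply: (iffP existsP) => [[e /andP[/eqP ev /existsP[f /andP[fg ef]]]]|].
  by exists e, f.
case=> e [f [ev fg ef]]; exists e; rewrite ev eqxx.
by apply/existsP; exists f; rewrite fg.
Qed.

Lemma vertex_below_cut_of I v :
  order_ideal I -> vertex_below (cut_of I) v = (v \in I).
Proof.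
move=> idI; apply/vertex_belowP/idP => [[e [f [ev fI ef]]]|vI].
  apply: contraTT fI => vI; rewrite inE negb_and (above_cut_of idI ef) //.
  by rewrite /starts_in ev.
have [e ev] := parent_edge v; have [q eq q0] := climb e.
have /hasP[f fq fI] : has (mem (cut_of I)) (e :: q).
  by rewrite has_count count_cut_of // /starts_in ev vI.
by exists e, f; split=> //; apply: path_connect eq _ _.
Qed.

Lemma below_ideal g : order_ideal [set v | vertex_below g v].
Proof.
apply/order_idealP => u v /arcP[e eu ev]; rewrite !inE.
case/vertex_belowP=> e' [f [e'v fg e'f]]; apply/vertex_belowP; exists e, f.
by split=> //; apply: connect_trans e'f; apply: connect1 (up_stepE ev e'v).
Qed.

(** If e leaves the set of vertices below g, a geodesic through e meets g in
    some edge f. Were f strictly above e, the target of e would be below g;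
    were f strictly below e, the source of e, being below g, would have another
    edge of g above it, on a common vertical path with f. *)
Lemma cut_of_below g : is_cut g -> cut_of [set v | vertex_below g v] = g.
Proof.
move=> cut_g; apply/setP => e; rewrite inE /starts_in /ends_in.
apply/andP/idP => [[lo hi]|eg]; last first.
  split.
    case se: (src e) => [v|] //; rewrite inE; apply/vertex_belowP.
    by exists e, e; rewrite connect0.
  case te: (tgt e) => [w|] //; rewrite inE; apply/vertex_belowP.
  case=> e' [f [e'w fg e'f]].
  by have := cut_antichain cut_g eg (up_stepE te e'w) e'f; rewrite fg.
have [f fg /orP[/connectP[[|e' q] /= + fE]|/connectP[q]]] := cut_meets e cut_g.
- by rewrite -fE.
- case/andP=> /andP[]; case te: (tgt e) hi => [w|] // hi _ /eqP e'w e'q.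
  case/negP: hi; rewrite inE; apply/vertex_belowP; exists e', f; split=> //.
  by apply/connectP; exists q.
case/lastP: q => [|q e'] /=; first by move=> _ ->.
rewrite rcons_path last_rcons => /andP[fq /andP[]] + + ee'; rewrite -ee'.
case te: (tgt (last f q)) => [v|] // _ /eqP ev.
move: lo; rewrite -ev inE => /vertex_belowP[e0 [f' [e0v f'g e0f']]].
have lt : up_step (last f q) e0 by apply: up_stepE te e0v.
case: q fq te lt {ev ee'} => [|d q] /=.
  by move=> _ _ fe0; have := cut_antichain cut_g fg fe0 e0f'; rewrite f'g.
case/andP=> fd dq _ le0; have de0 : connect (@up_step S) d e0.
  by apply/connectP; exists (rcons q e0); rewrite ?last_rcons // rcons_path dq.
by have := cut_antichain cut_g fg fd (connect_trans de0 e0f'); rewrite f'g.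
Qed.

Lemma sum_ideals_cuts (M : nmodType) (F : {set vertex S} -> M) :
  \sum_(I | order_ideal I) F I =
  \sum_(g : {set edge S} | `[< is_cut g >]) F [set v | vertex_below g v].
Proof.
rewrite (reindex_onto (fun g => [set v | vertex_below g v]) cut_of) /=.
  2: by move=> I idI; apply/setP => v; rewrite inE vertex_below_cut_of.
apply: eq_bigl => g; rewrite below_ideal /=; apply/eqP/asboolP => [<-|].
  exact/is_cut_cut_of/below_ideal.
exact: cut_of_below.
Qed.

Lemma vertex_aboveP g v :
  reflect (exists e f, [/\ tgt e = Some v, f \in g & connect (@up_step S) f e])
          (vertex_above g v).
Proof.
apply: (iffP existsP) => [[e /andP[/eqP ev /existsP[f /andP[fg ef]]]]|].
  by exists e, f.
case=> e [f [ev fg ef]]; exists e; rewrite ev eqxx.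
by apply/existsP; exists f; rewrite fg.
Qed.

Lemma connect_up_step f e e' : connect (@up_step S) f e -> up_step e e' ->
  exists2 f', up_step f f' & connect (@up_step S) f' e'.
Proof.
case/connectP=> [[|d q]] /=; first by move=> _ ->; exists e'.
case/andP=> fd dq -> qe'; exists d => //.
by apply/connectP; exists (rcons q e'); rewrite ?last_rcons // rcons_path dq.
Qed.

Lemma vertex_aboveE g v : is_cut g -> vertex_above g v = ~~ vertex_below g v.
Proof.
move=> cut_g; apply/idP/idP => [/vertex_aboveP[e [f [ev fg fe]]]|].
  apply/vertex_belowP => -[e' [f' [e'v f'g e'f']]].
  have [d fd de'] := connect_up_step fe (up_stepE ev e'v).
  by have := cut_antichain cut_g fg fd (connect_trans de' e'f'); rewrite f'g.
move/vertex_belowP => above; have [e ev] := child_edge v; apply/vertex_aboveP.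
have [f fg /orP[|fe]] := cut_meets e cut_g; last by exists e, f.
case/connectP=> [[|e' q]] /=.
  by move=> _ fe; exists e, e; rewrite -{2}fe connect0.
case/andP=> /andP[_ /eqP e'v] e'q fE; case: above; exists e', f.
rewrite -e'v; split=> //.
by apply/connectP; exists q.
Qed.

End Cuts.

(** * Separation of the components of an ideal or of its complement *)

Section Separation.
Variables (V : finType) (adj : rel V) (lab : V -> nat) (J : {set V}).
Variable H : V -> nat.

Definition within : rel V := [rel x y | [&& adj x y, x \in J & y \in J]].
Definition avoiding z : rel V := [rel x y | [&& adj x y, x != z & y != z]].

(** The vertex z separates a, on its left, from b, on its right. *)
Definition sided z a b :=
  (forall w, connect (avoiding z) a w -> lab w < lab z)%N /\
  (forall w, connect (avoiding z) b w -> lab z < lab w)%N.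

Hypothesis adjC : symmetric adj.
Hypothesis low : forall x y, x \in J -> y \notin J -> (H x < H y)%N.
Hypothesis adj_neq : forall x y, adj x y -> H x != H y.
Hypothesis peak : forall z a b, a != b -> adj a z -> adj z b ->
  (H a < H z)%N -> (H b < H z)%N -> sided z a b \/ sided z b a.

(** The vertex z of largest H on a simple path from u to v cannot be in J, for
    then the path would stay in J. Its neighbours on the path are strictly
    lower, so z separates them; and the components of u and v in J do not
    contain z, so each of them lies on one side of z. *)
Lemma separation u v : connect adj u v -> u \in J -> v \in J ->
  ~~ connect within u v ->
  (forall u' v', connect within u u' -> connect within v v' ->
     lab u' < lab v')%N \/
  (forall u' v', connect within u u' -> connect within v v' ->
     lab v' < lab u')%N.
Proof.
case/connectP=> p up vE uJ vJ.
case/shortenP: up vE => {}p up uniq_p _ vE uv.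
pose z := [arg max_(x > u | x \in u :: p) H x].
have [zp zmax] : z \in u :: p /\ forall x, x \in u :: p -> (H x <= H z)%N.
  by rewrite /z; case: arg_maxnP; rewrite ?mem_head.
have zJ : z \notin J.
  apply: contra uv => zJ; apply/connectP; exists p => //.
  have inJ x : x \in u :: p -> x \in J.
    by move=> xp; apply: contraTT (zmax x xp) => xJ; rewrite -ltnNge low.
  elim: p u up inJ {vE uJ zp zmax z zJ uniq_p} => //= y p IH u /andP[uy yp] inJ.
  apply/andP; split; first by rewrite /within /= uy !inJ ?inE ?eqxx ?orbT.
  apply: IH => // x xp.
  by apply: inJ; rewrite inE xp orbT.
have within_avoiding x y : connect within x y -> connect (avoiding z) x y.
  apply: connect_sub => a b /and3P[ab aJ bJ]; apply: connect1.
  rewrite /avoiding /= ab.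
  by rewrite (contraNneq _ zJ) => [|<-] //; rewrite (contraNneq _ zJ) // => <-.
move: zp zmax uniq_p up vE; rewrite inE => /predU1P[zu|].
  by rewrite zu uJ in zJ.
case/splitPr=> p1 [|b p2] zmax uniq_p.
  by rewrite last_cat /= => _ vE; rewrite -vE vJ in zJ.
rewrite cat_path last_cat /= => /and4P[up1 a_z zb bp2] vE.
move: uniq_p; rewrite -cat_cons cat_uniq /=.
case/and4P=> _ /norP[zp1 /norP[bp1 _]] zbp2 _.
pose a := last u p1; have ap1 : a \in u :: p1 by apply: mem_last.
have ab : a != b by apply: contraNneq bp1 => <-.
have Ha : (H a < H z)%N.
  by rewrite ltn_neqAle adj_neq // zmax // -cat_cons mem_cat ap1.
have Hb : (H b < H z)%N.
  rewrite ltn_neqAle eq_sym adj_neq // zmax //.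
  by rewrite -cat_cons mem_cat !inE eqxx !orbT.
have path_avoiding x q : path adj x q -> z \notin x :: q ->
    connect (avoiding z) x (last x q).
  elim: q x => //= y q IH x /andP[xy yq]; rewrite inE => /norP[zx zq].
  apply: connect_trans (IH y yq zq); apply: connect1.
  rewrite /avoiding /= xy eq_sym zx.
  by apply: contraNneq zq => ->; rewrite mem_head.
have au : connect (avoiding z) a u.
  rewrite (sym_connect_sym (e := avoiding z)); first exact: path_avoiding.
  by move=> x y; rewrite /avoiding /= adjC [X in _ && X]andbC.
have bv : connect (avoiding z) b v by rewrite vE; apply: path_avoiding.
case: (peak ab a_z zb Ha Hb) => -[lt_z gt_z]; [left|right] => u' v'.
  move=> /within_avoiding uu' /within_avoiding vv'.
  by apply: (@ltn_trans (lab z)); [apply: lt_z|apply: gt_z];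
     [apply: connect_trans au uu'|apply: connect_trans bv vv'].
move=> /within_avoiding uu' /within_avoiding vv'.
by apply: (@ltn_trans (lab z)); [apply: lt_z|apply: gt_z];
   [apply: connect_trans bv vv'|apply: connect_trans au uu'].
Qed.

End Separation.

Section InducedForest.
Variables (K : fieldType) (S : digraph).
Hypothesis hS : is_permutree S.
Implicit Types (u v w z a b : vertex S) (e : edge S).

(** What can be reached from a without passing through z lies in the branch of z
    through the edge that joins it to a. *)
Lemma sided_edges z a b e e' (A : {set edge S}) :
  left_right_edges z A -> e \in A -> e' \in A -> e != e' ->
  incident (inl a) (inr e) -> incident (inl b) (inr e') -> a != z -> b != z ->
  sided (@adjacent S) (@label S) z a b \/ sided (@adjacent S) (@label S) z b a.
Proof.
move=> [el [er [-> lab_l lab_r]]] eA e'A ee' ae be' az bz.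
have branchP d c w : incident (inl c) (inr d) -> c != z ->
    connect (avoiding (@adjacent S) z) c w -> w \in branch z d.
  move=> cd cz cw; rewrite inE.
  have offP x : (inl x : vertex S + edge S) \notin [set inl z] = (x != z).
    by rewrite in_set1.
  have off_edge d' : (inr d' : vertex S + edge S) \notin [set inl z].
    by rewrite in_set1.
  have dc : linked [set inl z] (inr d) (inl c).
    by apply: linked1; rewrite ?offP // incidentC.
  apply: linked_trans dc _.
  apply: (@connect_morph _ _ (avoiding (@adjacent S) z) _ inl) cw => x y.
  case/and3P=> /orP[] /arcP[f fx fy] xz yz.
    by apply: (linked_arc fx fy); rewrite ?offP.
  rewrite -/(linked _ _ _) linked_sym.
  by apply: (linked_arc fx fy); rewrite ?offP.
move: ee'; case/set2P: eA ae => ->; case/set2P: e'A be' => ->; rewrite ?eqxx //.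
  move=> be' ae _; left; split=> w cw.
    exact: lab_l (branchP _ _ _ ae az cw).
  exact: lab_r (branchP _ _ _ be' bz cw).
move=> be' ae _; right; split=> w cw.
  exact: lab_l (branchP _ _ _ be' bz cw).
exact: lab_r (branchP _ _ _ ae az cw).
Qed.

Variables (G : digraph) (f : vertex G -> vertex S) (J : {set vertex S}).
Hypothesis f_inj : injective f.
Hypothesis f_image : forall v, reflect (exists x, f x = v) (v \in J).
Hypothesis f_letter : forall x, letter x = letter (f x).
Hypothesis f_arc : forall x y, arc x y = arc (f x) (f y).

Variables (H : vertex S -> nat).
Hypothesis low : forall x y, x \in J -> y \notin J -> (H x < H y)%N.
Hypothesis H_monotone :
  (forall u v, arc u v -> H u < H v)%N \/ (forall u v, arc u v -> H v < H u)%N.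

(** If H increases upwards, lower neighbours of z are children of z; if H
    decreases upwards, they are its parents. In both cases z has two of them,
    one on the left and one on the right. *)
Lemma peak_sided z a b : a != b -> adjacent a z -> adjacent z b ->
  (H a < H z)%N -> (H b < H z)%N ->
  sided (@adjacent S) (@label S) z a b \/ sided (@adjacent S) (@label S) z b a.
Proof.
rewrite [adjacent z b]adjacentC => ab az bz Ha Hb.
have a_z : a != z by apply: contraTneq Ha => ->; rewrite ltnn.
have b_z : b != z by apply: contraTneq Hb => ->; rewrite ltnn.
have card2 (A : {set edge S}) e e' :
    #|A| \in [:: 1; 2]%N -> e \in A -> e' \in A -> e != e' -> #|A| = 2%N.
  rewrite !inE => /orP[/cards1P[d ->]|/eqP //].
  by rewrite !inE => /eqP-> /eqP->; rewrite eqxx.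
case: H_monotone => mono.
  have down c : adjacent c z -> (H c < H z)%N -> arc c z.
    by case/orP=> // /mono zc cz; have := ltn_trans zc cz; rewrite ltnn.
  have /arcP[e ea ez] := down a az Ha; have /arcP[e' e'b e'z] := down b bz Hb.
  have ee' : e != e'.
    by apply: contraNneq ab => ee'; rewrite ee' e'b in ea; case: ea => ->.
  have eA : e \in child_edges z by rewrite inE ez.
  have e'A : e' \in child_edges z by rewrite inE e'z.
  have two := card2 _ _ _ (permutree_children hS z) eA e'A ee'.
  apply: (sided_edges (permutree_descendants hS two) eA e'A ee') => //=.
    by rewrite ea eqxx.
  by rewrite e'b eqxx.
have up c : adjacent c z -> (H c < H z)%N -> arc z c.
  by case/orP=> // /mono zc cz; have := ltn_trans zc cz; rewrite ltnn.
have /arcP[e ez ea] := up a az Ha; have /arcP[e' e'z e'b] := up b bz Hb.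
have ee' : e != e'.
  by apply: contraNneq ab => ee'; rewrite ee' e'b in ea; case: ea => ->.
have eA : e \in parent_edges z by rewrite inE ez.
have e'A : e' \in parent_edges z by rewrite inE e'z.
have two := card2 _ _ _ (permutree_parents hS z) eA e'A ee'.
apply: (sided_edges (permutree_ancestors hS two) eA e'A ee') => //=.
  by rewrite ea eqxx orbT.
by rewrite e'b eqxx orbT.
Qed.

(** Here G is the digraph induced on J, seen through an embedding f because its
    vertices form a type of their own. *)
Lemma prod_trees_induced :
  \big[@hmul K/hone K]_(T <- trees G) basisP T K =
  sumF K (@arc S) (@letter S) (enum J).
Proof.
have f_lab (u : vertex G) : label u = label (f u) by have [] := f_letter u.
have inJ (u : vertex G) : f u \in J by apply/f_image; exists u.
have f_adj (u v : vertex G) : adjacent u v = adjacent (f u) (f v).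
  by rewrite /adjacent /= !f_arc.
have toJ (u v : vertex G) : connect (@adjacent G) u v ->
    connect (within (@adjacent S) J) (f u) (f v).
  apply: connect_morph => x y xy; apply: connect1.
  by rewrite /within /= !inJ !andbT; move: xy; rewrite f_adj.
have ofJ (u v : vertex G) : connect (within (@adjacent S) J) (f u) (f v) ->
    connect (@adjacent G) u v.
  case/connectP=> p; elim: p u => [|x p IH] u /=.
    by move=> _ /f_inj->; apply: connect0.
  case/andP=> /and3P[ux _ /f_image[y yx]]; rewrite -yx => yp vE.
  by apply: connect_trans (IH y yp vE); apply: connect1; rewrite f_adj yx.
rewrite prod_trees.
- rewrite -(perm_sumF K (@arc S) (@letter S) (A := map f (enum (vertex G)))).
    rewrite [RHS]sumF_map // /sumF; apply: eq_big => [s|s _].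
      by apply: eq_pairwise => u v /=; rewrite f_arc.
    by congr (basisF K (to_dperm (std _))); apply: eq_map => u; apply: f_letter.
  apply: uniq_perm => [||v].
  + by rewrite (map_inj_uniq f_inj) enum_uniq.
  + exact: enum_uniq.
  rewrite mem_enum; apply/mapP/f_image => [[u _ ->]|[u <-]]; exists u => //.
  exact: mem_enum.
- by move=> u v; rewrite !f_lab => /(permutree_label_inj hS)/f_inj.
- by move=> u; rewrite f_arc arc_irreflexive.
move=> u v uv.
have adj_neq x y : adjacent x y -> H x != H y.
  by case/orP=> xy; case: H_monotone => /(_ _ _ xy); rewrite neq_ltn => ->;
     rewrite ?orbT.
have fufv : connect (@adjacent S) (f u) (f v).
  by rewrite -linked0E (permutree_connected hS).
have := separation (@adjacentC S) low adj_neq peak_sided fufv (inJ u) (inJ v).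
move/(_ (contra (@ofJ u v) uv)) => [lt|lt]; [left|right] => u' v' uu' vv';
  by rewrite !f_lab; apply: lt; apply: toJ.
Qed.

End InducedForest.

(** * The forests below and above a cut *)

Section CutForests.
Variables (K : fieldType) (S : digraph) (g : {set edge S}).
Hypothesis hS : is_permutree S.
Hypothesis cut_g : is_cut g.
Implicit Types (u v : vertex S) (e : edge S).
Local Notation I := [set v | vertex_below g v].
Local Notation N := #|vertex S|.+1.
Local Notation sumF := (sumF K (@arc S) (@letter S)).

(** All the edges at a vertex below the cut are kept in the forest below it, so
    the vertex keeps its decoration there. *)
Lemma vertex_below_edges v e : vertex_below g v ->
  src e = Some v \/ tgt e = Some v -> edge_below g e.
Proof.
move=> vI [] ev.
  have [f fg /orP[ef|fe]] := cut_meets hS e cut_g.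
    by apply/existsP; exists f; rewrite fg.
  have [fe'|fe'] := eqVneq f e.
    by apply/existsP; exists f; rewrite fg fe' connect0.
  exfalso; move: vI; apply/negP; rewrite -(vertex_aboveE hS) //.
  case/connectP: fe => q; case/lastP: q => [|q d] /=.
    by move=> _ e_f; rewrite e_f eqxx in fe'.
  rewrite rcons_path last_rcons => /andP[fq /andP[_ /eqP qd]] ed.
  apply/vertex_aboveP; exists (last f q), f; split=> //.
    by rewrite qd -ed.
  by apply/connectP; exists q.
case/vertex_belowP: vI => d [f [dv fg df]]; apply/existsP; exists f; rewrite fg.
exact: connect_trans (connect1 (up_stepE ev dv)) df.
Qed.

Lemma prod_below_trees :
  \big[@hmul K/hone K]_(T <- below_trees g) basisP T K = sumF (enum I).
Proof.
have not_cut e v : tgt e = Some v -> vertex_below g v -> e \notin g.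
  move=> ev /vertex_belowP[d [f [dv fg df]]]; apply/negP => eg.
  by have := cut_antichain hS cut_g eg (up_stepE ev dv) df; rewrite fg.
have srcE (e : edge (below g)) (u : vertex (below g)) :
    (src e == Some u) = (src (val e) == Some (val u)) by apply: obind_insub.
have tgtE (e : edge (below g)) (u : vertex (below g)) :
    (tgt e == Some u) = (tgt (val e) == Some (val u)).
  rewrite /=; case: ifP => [eg|_]; last exact: obind_insub.
  by apply/esym/negP => /eqP/not_cut/(_ (valP u)); rewrite eg.
(* The offset N exceeds all heights and places the vertices of I first. *)
pose H v := (height v + (v \notin I) * N)%N.
apply: (@prod_trees_induced K S hS (below g) val I _ _ _ _ H).
- exact: val_inj.
- move=> v; apply: (iffP idP) => [|[x <-]]; rewrite inE; last exact: (valP x).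
  by move=> vI; exists (Sub v vI); rewrite SubK.
- move=> x; congr (_, deco_of_bools (_ == 2%N, _ == 2%N));
    apply: card_val_set => e; rewrite !inE ?srcE ?tgtE // => /eqP ex.
    by apply: vertex_below_edges (valP x) _; left.
  by apply: vertex_below_edges (valP x) _; right.
- move=> x y; apply/arcP/arcP => [[e /eqP + /eqP]|[e ex ey]].
    by rewrite srcE tgtE => /eqP ? /eqP ?; exists (val e).
  have eI : edge_below g e by apply: vertex_below_edges (valP x) _; left.
  by exists (Sub e eI); apply/eqP; rewrite ?srcE ?tgtE SubK ?ex ?ey.
- move=> x y xI yI; rewrite /H xI yI mul1n mul0n addn0.
  by apply: leq_ltn_trans (max_card _) _; rewrite addnC leq_addr.
left=> u v uv; rewrite /H -addSn leq_add ?height_lt // leq_mul2r.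
have := order_idealP _ (below_ideal g) u v uv.
by case: (v \in I) => [->|] //; rewrite leq_b1 orbT.
Qed.

Lemma vertex_above_edges v e : vertex_above g v ->
  src e = Some v \/ tgt e = Some v -> edge_above g e.
Proof.
move=> va [] ev.
  case/vertex_aboveP: va => d [f [dv fg df]].
  apply/existsP; exists f; rewrite fg.
  exact: connect_trans df (connect1 (up_stepE dv ev)).
have [f fg /orP[/connectP[[|d q]]|fe]] := cut_meets hS e cut_g.
- by move=> _ /= fe; apply/existsP; exists f; rewrite fg fe connect0.
- move=> /= /andP[/andP[_ /eqP ed] dq] fE; exfalso; move: va; apply/negP.
  rewrite (vertex_aboveE hS) // negbK; apply/vertex_belowP; exists d, f.
  by rewrite -ed; split=> //; apply/connectP; exists q.
by apply/existsP; exists f; rewrite fg.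
Qed.

Lemma prod_above_trees :
  \big[@hmul K/hone K]_(T <- above_trees g) basisP T K = sumF (enum (~: I)).
Proof.
have not_cut e v : src e = Some v -> vertex_above g v -> e \notin g.
  move=> ev /vertex_aboveP[d [f [dv fg fd]]]; apply/negP => eg.
  have [f' ff' f'e] := connect_up_step fd (up_stepE dv ev).
  by have := cut_antichain hS cut_g fg ff' f'e; rewrite eg.
have srcE (e : edge (above g)) (u : vertex (above g)) :
    (src e == Some u) = (src (val e) == Some (val u)).
  rewrite /=; case: ifP => [eg|_]; last exact: obind_insub.
  by apply/esym/negP => /eqP/not_cut/(_ (valP u)); rewrite eg.
have tgtE (e : edge (above g)) (u : vertex (above g)) :
    (tgt e == Some u) = (tgt (val e) == Some (val u)) by apply: obind_insub.
(* The numbering is reversed so that the complement of I comes first. *)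
pose H v := (N - height v + (v \in I) * N)%N.
apply: (@prod_trees_induced K S hS (above g) val (~: I) _ _ _ _ H).
- exact: val_inj.
- move=> v; apply: (iffP idP) => [|[x <-]]; rewrite !inE -(vertex_aboveE hS) //.
    by move=> va; exists (Sub v va); rewrite SubK.
  exact: (valP x).
- move=> x; congr (_, deco_of_bools (_ == 2%N, _ == 2%N));
    apply: card_val_set => e; rewrite !inE ?srcE ?tgtE // => /eqP ex.
    by apply: vertex_above_edges (valP x) _; left.
  by apply: vertex_above_edges (valP x) _; right.
- move=> x y; apply/arcP/arcP => [[e /eqP + /eqP]|[e ex ey]].
    by rewrite srcE tgtE => /eqP ? /eqP ?; exists (val e).
  have ea : edge_above g e by apply: vertex_above_edges (valP x) _; left.
  by exists (Sub e ea); apply/eqP; rewrite ?srcE ?tgtE SubK ?ex ?ey.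
- move=> x y; rewrite in_setC => /negPf xI /setCP/contrapT yI.
  rewrite /H xI yI mul1n mul0n addn0 -[X in (X <= _)%N]addn0.
  have Nx := height_gt0 x.
  apply: (@leq_trans N); first by rewrite addn0 ltn_subrL Nx.
  exact: leq_addl.
right=> u v uv; rewrite /H -addSn leq_add //.
  by apply: ltn_sub2l (height_lt hS uv); rewrite ltnS max_card.
rewrite leq_mul2r; have := order_idealP _ (below_ideal g) u v uv.
by case: (v \in I) => [->|] //; rewrite orbT.
Qed.

End CutForests.

Theorem proposition62 (K : fieldType) (S : digraph) (hS : is_permutree S) :
  coproduct (basisP S K) =
  \sum_(g : {set edge S} | `[< is_cut g >])
     tensor (\big[@hmul K/hone K]_(T <- below_trees g) basisP T K)
            (\big[@hmul K/hone K]_(T <- above_trees g) basisP T K).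
Proof.
rewrite (coproduct_basisP K hS (arc_irreflexive hS)) (sum_ideals_cuts hS).
apply: eq_bigr => g /asboolP cut_g.
by rewrite (prod_below_trees K hS cut_g) (prod_above_trees K hS cut_g).
Qed.
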